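(* Let the structural assumptions (A1)–(A5) listed in the context hold at $\hat u=(\hat x,\hat y)\in H^{-1}(0)$ for some $L\ge 0$, $R_K>0$, $\lambda\ge 0$, $\theta\ge0$, $p\in[1,2]$, and $\rho_y\ge 0$, with $\tilde\gamma_G>0$. Suppose that for some $\zeta>0$ $$\tilde\gamma_{F^*}:=\min\{\gamma_{\mathrm L},\ \gamma_{\mathrm{NL}}-(p-1)\zeta\}>0\quad\text{and}\quad \theta\ge\rho_y^{2-p}p^{-p}\omega^{-1}\zeta^{1-p},$$ and that the iterates $u^i=(x^i,y^i)$ are generated by the NL-PDHGM algorithm (see context) with constant parameters $$0<\tau_i\equiv\tau\le\min\left\{\frac{\delta}{3L\rho_y+\lambda},\ \frac{\sqrt{(1-\kappa)\tilde\gamma_{F^*}/\tilde\gamma_G}}{R_K}\right\},\qquad \sigma_i\equiv\sigma:=\frac{\tilde\gamma_G}{\tilde\gamma_{F^*}}\tau,\qquad \omega_i\equiv\omega:=\frac{1}{1+2\tilde\gamma_G\tau}$$ for some $0\le\delta\le\kappa<1$. Then $\|u^N-\hat u\|^2$ converges to zero at the rate $O(\omega^N)$.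
   Context: $X,Y$ are Hilbert spaces; $G:X\to(-\infty,\infty]$ and $F^*:Y\to(-\infty,\infty]$ are convex, proper and lower semicontinuous; $K\in C^1(X;Y)$ is a possibly nonlinear operator with Fréchet derivative $\nabla K(x)$. For a bounded operator $T$, $\|x\|_T^2:=\langle Tx,x\rangle$. The set-valued map $H:X\times Y\rightrightarrows X\times Y$ is $$H(x,y)=\begin{pmatrix}\partial G(x)+[\nabla K(x)]^*y\\ \partial F^*(y)-K(x)\end{pmatrix},\qquad H^{-1}(0)=\{u: 0\in H(u)\}.$$ NL-PDHGM algorithm: given a starting point $(x^0,y^0)$ and $\tau_i,\sigma_{i+1},\omega_i>0$, for $i=0,1,2,\dots$ $$x^{i+1}=(I+\tau_i\partial G)^{-1}(x^i-\tau_i[\nabla K(x^i)]^*y^i),\quad \bar x^{i+1}=x^{i+1}+\omega_i(x^{i+1}-x^i),\quad y^{i+1}=(I+\sigma_{i+1}\partial F^* )^{-1}(y^i+\sigma_{i+1}K(\bar x^{i+1})).$$ Subspaces: $Y_{\mathrm L}:=\{y\in Y: x\mapsto\langle y,K(x)\rangle\text{ is linear}\}$, $Y_{\mathrm{NL}}:=Y_{\mathrm L}^\perp$; $P_{\mathrm L},P_{\mathrm{NL}}$ are the orthogonal projections onto them; $\mathbb B_{\mathrm{NL}}(\hat y,r):=\{y\in Y:\|y-\hat y\|_{P_{\mathrm{NL}}}\le r\}$. A set-valued map $A$ on a Hilbert space is $\Gamma$-strongly monotone at $\hat v$ for $\hat w\in A(\hat v)$ in a neighborhood $\mathcal V$ of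 $\hat v$ if $\langle w-\hat w,v-\hat v\rangle\ge\|v-\hat v\|_\Gamma^2$ for all $v\in\mathcal V$, $w\in A(v)$ (here $\Gamma\ge 0$). Structural assumptions at $\hat u=(\hat x,\hat y)\in H^{-1}(0)$, with $\mathcal X_K$ and $\mathcal X_G$ neighborhoods of $\hat x$, $\mathcal Y_{F^*}$ a neighborhood of $\hat y$, constants $\gamma_G,\tilde\gamma_G,\gamma_{\mathrm L},\gamma_{\mathrm{NL}}\ge 0$, and $\mathcal U(\rho_y):=(\mathcal X_G\cap\mathcal X_K)\times(\mathbb B_{\mathrm{NL}}(\hat y,\rho_y)\cap\mathcal Y_{F^*})$: (A1) $\|\nabla K(x)-\nabla K(x')\|\le L\|x-x'\|$ for all $x,x'\in\mathcal X_K$. (A2) $\sup_{x\in\mathcal X_K}\|\nabla K(x)\|\le R_K$. (A3) $\partial G$ is $\gamma_G I$-strongly monotone at $\hat x$ for $-[\nabla K(\hat x)]^*\hat y$ in $\mathcal X_G$, and $\partial F^*$ is $(\gamma_{\mathrm L}P_{\mathrm L}+\gamma_{\mathrm{NL}}P_{\mathrm{NL}})$-strongly monotone at $\hat y$ for $K(\hat x)$ in $\mathcal Y_{F^*}$. (A4) For all $x,x'\in\mathcal X_K$: $\langle[\nabla K(x')-\nabla K(\hat x)]^*\hat y,x-\hat x\rangle+(\gamma_G-\tilde\gamma_G)\|x-\hat x\|^2\ge\theta\|K(\hat x)-K(x)-\nabla K(x)(\hat x-x)\|^p-\frac{\lambda}{2}\|x-x'\|^2$. (A5) The iterates satisfy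 $u^i\in\mathcal U(\rho_y)$ and $\bar x^{i+1}\in\mathcal X_K$ for all $i\in\mathbb N=\{0,1,2,\dots\}$. Conventions: $0^0=1$; if $3L\rho_y+\lambda=0$, then $\delta/(3L\rho_y+\lambda)$ is read as $+\infty$ when $\delta>0$ and as $0$ when $\delta=0$.
   Formalization: The neighborhood X_K of x̂ is additionally assumed convex; for arbitrary (e.g. disconnected) neighborhoods the claim fails, as there are examples meeting all assumptions with periodic, non-convergent iterates. *)

(* Defs.v *)
From HB Require Import structures.
From mathcomp Require Import all_boot all_order all_algebra.
From mathcomp Require Import all_classical all_reals all_analysis.

Set Implicit Arguments.
Unset Strict Implicit.
Unset Printing Implicit Defensive.

Import Order.TTheory GRing.Theory Num.Theory.
Import numFieldNormedType.Exports.

Local Open Scope classical_set_scope.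
Local Open Scope ring_scope.

(* A real Hilbert space is a complete normed module whose norm comes from a
   positive definite symmetric bilinear form. *)
HB.mixin Record CompleteNormedModule_isHilbert (R : realType) X
    of CompleteNormedModule R X := {
  hdot : {dot X for idfun} ;
  hdotE : forall x : X, hdot x x = `|x| ^+ 2
}.

#[short(type="hilbertType")]
HB.structure Definition Hilbert (R : realType) :=
  {X of CompleteNormedModule_isHilbert R X & CompleteNormedModule R X}.

Notation "''[' u , v ]" := (hdot u v) : ring_scope.

Section Operators.
Context {R : realType}.

(* Extended-real valued, hence +oo on an unbounded operator. *)
Definition opnorm (U W : normedModType R) (T : U -> W) : \bar R :=
  ereal_sup [set `|T h|%:E | h in [set h : U | `|h| <= 1]].

Definition C1 (U W : normedModType R) (K : U -> W) : Prop :=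
  (forall x, differentiable K x) /\
  (forall x, opnorm ('d K z \- 'd K x) @[z --> x] --> 0%E).

(* For continuous linear T, the vector below exists and is unique by the Riesz
   representation theorem; the default value 0 is then never used. *)
Definition adjoint (X Y : hilbertType R) (T : X -> Y) (y : Y) : X :=
  xget 0 [set x | forall h, '[x, h] = '[y, T h]].

Definition orthogonal_compl (Y : hilbertType R) (S : set Y) : set Y :=
  [set y | forall z, S z -> '[y, z] = 0].

(* For a closed subspace S, the vector below exists and is unique by the
   projection theorem. *)
Definition orthogonal_proj (Y : hilbertType R) (S : set Y) (y : Y) : Y :=
  xget 0 [set z | S z /\ orthogonal_compl S (y - z)].

(* ||x||_T ^ 2 *)
Definition sqnorm_op (X : hilbertType R) (T : X -> X) (x : X) : R := '[T x, x].

Section Subspaces.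
Context {X Y : hilbertType R}.
Variable K : X -> Y.

Definition Y_L : set Y := [set y | scalar (fun x : X => '[y, K x])].
Definition Y_NL : set Y := orthogonal_compl Y_L.
Definition P_L : Y -> Y := orthogonal_proj Y_L.
Definition P_NL : Y -> Y := orthogonal_proj Y_NL.
Definition ball_NL (yh : Y) (r : R) : set Y :=
  [set y | Num.sqrt (sqnorm_op P_NL (y - yh)) <= r].
End Subspaces.

Definition proper_function (X : hilbertType R) (f : X -> \bar R) : Prop :=
  (forall x, f x != -oo%E) /\ (exists x, (f x < +oo)%E).

(* The library's convex_function is restricted to real-valued functions. Recall
   that 0 * +oo = 0 in \bar R, so the end points t = 0, 1 are harmless. *)
Definition convex_efunction (X : hilbertType R) (f : X -> \bar R) : Prop :=
  forall (x y : X) (t : R), 0 <= t <= 1 ->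
    (f (t *: x + (1 - t) *: y)%R <= t%:E * f x + (1 - t)%:E * f y)%E.

(* Empty at the points where a proper f takes the value +oo. *)
Definition subdifferential (X : hilbertType R) (f : X -> \bar R) (x : X) :
    set X :=
  [set q | forall z, (f x + '[q, z - x]%:E <= f z)%E].

Definition strongly_monotone_at (X : hilbertType R) (A : X -> set X)
    (Gamma : X -> X) (vh wh : X) (V : set X) : Prop :=
  A vh wh /\
  forall v w, V v -> A v w -> '[w - wh, v - vh] >= sqnorm_op Gamma (v - vh).

(* (I + t A)^-1 as a set-valued map. *)
Definition resolvent (X : hilbertType R) (t : R) (A : X -> set X) (v : X) :
    set X :=
  [set x | exists2 q, A x q & v = x + t *: q].

Section Saddle.
Context {X Y : hilbertType R}.
Variables (G : X -> \bar R) (Fs : Y -> \bar R) (K : X -> Y).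

Definition H_map (u : X * Y) : set (X * Y) :=
  [set q + adjoint ('d K (u.1)) u.2 | q in subdifferential G u.1] `*`
  [set r - K u.1 | r in subdifferential Fs u.2].

(* xbar omega x i is the extrapolated point of index i + 1. *)
Definition xbar (omega : nat -> R) (x : nat -> X) (i : nat) : X :=
  x i.+1 + omega i *: (x i.+1 - x i).

(* The resolvents of the subdifferentials of convex, proper and lower
   semicontinuous functions are single-valued, so that membership here is the
   equality written in the algorithm. *)
Definition NL_PDHGM (tau sigma omega : nat -> R) (u : nat -> X * Y) : Prop :=
  forall i : nat,
    let x := fst \o u in let y := snd \o u in
    resolvent (tau i) (subdifferential G)
      (x i - tau i *: adjoint ('d K (x i)) (y i)) (x i.+1) /\
    resolvent (sigma i.+1) (subdifferential Fs)
      (y i + sigma i.+1 *: K (xbar omega x i)) (y i.+1).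
End Saddle.

(* The Hilbert norm of the product space; the library's norm on X * Y is the
   maximum of the two norms. *)
Definition sqnorm_pair (X Y : hilbertType R) (u : X * Y) : R :=
  `|u.1| ^+ 2 + `|u.2| ^+ 2.

End Operators.

(* Main.v *)
(** The energy
    [|x - xh|^2 / (2 tau) - <y - yh, K'(x)(x - xh)>
     + |y - yh|^2 / (2 sigma omega)]
    contracts by the factor [omega] at every step. Testing the primal inclusion
    with [x' - xh] and the dual one with [(y' - yh) / omega], the strong
    monotonicity terms turn the weights of the new iterate into [1 / omega]
    times those of the old one, as [omega^-1 = 1 + 2 tgG tau = 1 + 2 tgF sigma].
    What remains is the nonlinear coupling. It only sees the [Y_NL]-component
    of [y' - yh], since elements of [Y_L] annihilate the linearisation errors
    of [K]. Its first part, the remainder of [K] between [x'] and [xh], is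
    absorbed by the three-point condition and Young's inequality with exponent
    [p]; the others are quadratic in [x' - x] with constant [3/2 L rho] and are
    absorbed by the proximal term thanks to the step length bound. Finally
    [omega < 1] makes the energy coercive. *)
Require Import Defs.
From mathcomp Require Import all_boot all_order all_algebra.
From mathcomp Require Import all_classical all_reals all_analysis.
From mathcomp Require Import ring lra.
Import Order.TTheory GRing.Theory Num.Theory.
Import numFieldNormedType.Exports.
Local Open Scope classical_set_scope.
Local Open Scope ring_scope.

(** * Inner product calculus and Riesz representation on closed subspaces *)

Section HilbertSpace.
Context {R : realType} {X : hilbertType R}.
Implicit Types x y z : X.

Lemma hdotC x y : '[x, y] = '[y, x].
Proof. by rewrite hermC expr0 mul1r. Qed.

Lemma hdotDl x y z : '[x + y, z] = '[x, z] + '[y, z].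
Proof. exact: linearDl. Qed.

Lemma hdotBl x y z : '[x - y, z] = '[x, z] - '[y, z].
Proof. exact: linearBl. Qed.

Lemma hdotNl x z : '[- x, z] = - '[x, z].
Proof. exact: linearNl. Qed.

Lemma hdotZl (a : R) x y : '[a *: x, y] = a * '[x, y].
Proof. exact: linearZl_LR. Qed.

Lemma hdot0l x : '[0, x] = 0.
Proof. exact: linear0l. Qed.

Lemma hdotDr x y z : '[z, x + y] = '[z, x] + '[z, y].
Proof. exact: linearDr. Qed.

Lemma hdotBr x y z : '[z, x - y] = '[z, x] - '[z, y].
Proof. exact: linearBr. Qed.

Lemma hdotZr (a : R) x y : '[x, a *: y] = a * '[x, y].
Proof. exact: linearZr_LR. Qed.

Lemma hdot_eq0 x : '[x, x] = 0 -> x = 0.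
Proof. by rewrite hdotE => /eqP; rewrite sqrf_eq0 normr_eq0 => /eqP. Qed.

Lemma sqr_normD x y : `|x + y| ^+ 2 = `|x| ^+ 2 + 2 * '[x, y] + `|y| ^+ 2.
Proof. by rewrite -!hdotE hdotDl !hdotDr (hdotC y x); ring. Qed.

Lemma sqr_normB x y : `|x - y| ^+ 2 = `|x| ^+ 2 - 2 * '[x, y] + `|y| ^+ 2.
Proof. by rewrite -!hdotE hdotBl !hdotBr (hdotC y x); ring. Qed.

(** For nonzero vectors, the squared norm of [|y| x - |x| y] is [2 |x| |y| (|x| |y| - <x, y>)]. *)
Lemma hdot_le_norm x y : '[x, y] <= `|x| * `|y|.
Proof.
have [->|x0] := eqVneq x 0; first by rewrite hdot0l normr0 mul0r.
have [->|y0] := eqVneq y 0; first by rewrite hdotC hdot0l normr0 mulr0.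
have xy0 : 0 < `|x| * `|y| by rewrite mulr_gt0 ?normr_gt0.
have := sqr_ge0 `| `|y| *: x - `|x| *: y |.
rewrite sqr_normB !normrZ !normr_id hdotZl hdotZr => h.
rewrite -subr_ge0 -(pmulr_rge0 _ xy0); nra.
Qed.

Lemma normr_hdot x y : `|'[x, y]| <= `|x| * `|y|.
Proof.
rewrite ler_norml hdot_le_norm andbT lerNl -hdotNl.
by rewrite (le_trans (hdot_le_norm _ _))// normrN.
Qed.

(* The representing vector minimises |x|^2 - 2 f x over S; by the parallelogram
   identity every minimising sequence is a Cauchy sequence. *)
Lemma riesz_subspace (S : set X) (f : X -> R) (M : R) :
  closed S -> S 0 -> (forall a x y, S x -> S y -> S (a *: x + y)) ->
  scalar f -> (forall x, `|f x| <= M * `|x|) ->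
  exists2 z, S z & forall h, S h -> '[z, h] = f h.
Proof.
move=> clS S0 Slin flin fM.
have fP a x y : f (a *: x + y) = a * f x + f y by rewrite flin.
have SD x y : S x -> S y -> S (x + y).
  by move=> Sx Sy; rewrite -[x]scale1r; exact: Slin.
have SZ a x : S x -> S (a *: x).
  by move=> Sx; rewrite -[_ *: _]addr0; exact: Slin.
have fD x y : f (x + y) = f x + f y by rewrite -{1}[x]scale1r fP mul1r.
have f0 : f 0 = 0 by have := fD 0 0; rewrite addr0 => h; lra.
have fZ a x : f (a *: x) = a * f x by rewrite -[_ *: _]addr0 fP f0 addr0.
pose J x : R := `|x| ^+ 2 - 2 * f x.
have J_lb x : - M ^+ 2 <= J x.
  have := fM x; rewrite ler_norml /J => /andP[_ fx].
  by have := sqr_ge0 (`|x| - M); nra.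
pose m := inf (J @` S).
have hasm : has_inf (J @` S).
  split; first by exists (J 0), 0.
  by exists (- M ^+ 2) => _ [x _ <-].
have m_le x : S x -> m <= J x.
  by move=> Sx; apply: ge_inf; [exact: hasm.2|exists x].
have JD x y : J (x + y) = J x + 2 * ('[x, y] - f y) + `|y| ^+ 2.
  by rewrite /J sqr_normD fD; ring.
have near_min x y (e : R) : S x -> S y -> J x <= m + e -> J y <= m + e ->
    `|x - y| ^+ 2 <= 4 * e.
  move=> Sx Sy Jx Jy.
  have := m_le (2^-1 *: (x + y)) (SZ _ _ (SD _ _ Sx Sy)).
  move: Jx Jy; rewrite /J sqr_normB normrZ exprMn sqr_normD fZ fD.
  by rewrite ger0_norm// => h1 h2 h3; lra.
have approx n : exists x, S x /\ J x <= m + n.+1%:R^-1.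
  have n0 : 0 < n.+1%:R^-1 :> R by rewrite invr_gt0.
  have [_ [x Sx <-] Jx] := inf_adherent n0 hasm.
  by exists x; split=> //; exact: ltW.
have [xs xsP] := choice approx.
have inv_small (e : R) : 0 < e -> exists n, n.+1%:R^-1 < e.
  move=> e0; exists (Num.truncn e^-1).
  by rewrite -ltf_pV2 ?(posrE,divr_gt0)// invrK truncnS_gt.
have inv_le i n : (n <= i)%N -> i.+1%:R^-1 <= n.+1%:R^-1 :> R.
  by move=> ni; rewrite lef_pV2 ?posrE ?ler_nat.
have : cvg (xs @ \oo).
  apply/cauchy_cvgP/cauchy_exP => e e0.
  have [n ne] : exists n, n.+1%:R^-1 < e ^+ 2 / 4.
    by apply: inv_small; rewrite divr_gt0// exprn_gt0.
  exists (xs n), n => // i /= ni; rewrite -ball_normE /=.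
  have [Sn Jn] := xsP n; have [Si Ji] := xsP i.
  have h : `|xs n - xs i| ^+ 2 <= 4 * n.+1%:R^-1.
    by apply: near_min => //; apply: (le_trans Ji); rewrite lerD2l inv_le.
  rewrite -(ltr_pXn2r (n := 2)) ?nnegrE ?(ltW e0)//.
  by rewrite (le_lt_trans h)// mulrC -ltr_pdivlMr.
move=> /cvg_ex[z zP]; exists z.
  by apply: (closed_cvg S clS _ z zP); apply: nearW => n; case: (xsP n).
move=> h Sh.
have close (e : R) : 0 < e ->
    exists x, [/\ S x, `|z - x| <= e & J x <= m + e ^+ 2].
  move=> e0; have [n ne] := inv_small _ (exprn_gt0 2 e0).
  have [k _ kP] : \forall k \near \oo, `|z - xs k| < e.
    by move/cvgrPdist_lt : zP; exact.
  exists (xs (maxn n k)); have [Sx Jx] := xsP (maxn n k); split=> //.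
    by apply/ltW/kP => /=; exact: leq_maxr.
  apply: (le_trans Jx); rewrite lerD2l (le_trans (inv_le _ _ (leq_maxl n k)))//.
  exact: ltW.
have est (e : R) : 0 < e -> `|'[z, h] - f h| <= 2 * `|h| * e.
  move=> e0; have [x [Sx zx Jx]] := close _ e0.
  have dzx : `|'[z - x, h]| <= `|h| * e.
    by rewrite (le_trans (normr_hdot _ _))// mulrC ler_wpM2l.
  have dx : `|'[x, h] - f h| <= `|h| * e.
    (* [J x] exceeds the infimum by at most [e ^+ 2], so moving along [h] cannot lower it by more.
       At the vertex [t = - d / |h|^2], with [d = <x, h> - f h], this reads [d^2 <= e^2 |h|^2]. *)
    have quad t : 0 <= e ^+ 2 + 2 * t * ('[x, h] - f h) + t ^+ 2 * `|h| ^+ 2.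
      have := m_le (x + t *: h) (SD _ _ Sx (SZ _ _ Sh)).
      rewrite JD hdotZr fZ normrZ exprMn real_normK ?num_real//.
      by move=> hm; nra.
    have [h0|h0] := eqVneq h 0.
      by rewrite h0 hdotC hdot0l f0 normr0 subrr normr0 mul0r.
    have hp : 0 < `|h| by rewrite normr_gt0.
    rewrite -(ler_pXn2r (n := 2)) ?nnegrE// ?mulr_ge0 ?(ltW e0)//.
    rewrite real_normK ?num_real//.
    have := quad (- ('[x, h] - f h) / `|h| ^+ 2).
    set d := '[x, h] - f h => q.
    have -> : d ^+ 2 = (e ^+ 2 - (e ^+ 2 + 2 * (- d / `|h| ^+ 2) * d +
        (- d / `|h| ^+ 2) ^+ 2 * `|h| ^+ 2)) * `|h| ^+ 2.
      by field; rewrite gt_eqF.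
    have -> : (`|h| * e) ^+ 2 = e ^+ 2 * `|h| ^+ 2 by ring.
    by rewrite ler_wpM2r ?sqr_ge0//; lra.
  have -> : '[z, h] - f h = '[z - x, h] + ('[x, h] - f h).
    by rewrite hdotBl; ring.
  by rewrite (le_trans (ler_normD _ _))//; lra.
apply/eqP; rewrite -subr_eq0 -normr_le0; apply/ler_addgt0Pr => e e0.
(* The added [1] keeps the divisor positive when [h = 0]. *)
rewrite add0r; pose t := e / (2 * `|h| + 1).
have hp : 0 < 2 * `|h| + 1 by rewrite ltr_wpDl// mulr_ge0.
rewrite (le_trans (est t _)) ?divr_gt0//.
by rewrite mulrA ler_pdivrMr// mulrC ler_wpM2l ?(ltW e0)// lerDl.
Qed.

End HilbertSpace.

(** * Adjoints and orthogonal projections *)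

Section AdjointAndProjection.
Context {R : realType}.

Lemma continuous_hdot (X : hilbertType R) (w : X) :
  continuous (fun x : X => '[w, x] : R^o).
Proof.
apply: (@bounded_linear_continuous _ _ _ (hdot w : {linear X -> R^o})).
apply/linear_boundedP; near=> r => x.
rewrite (le_trans (normr_hdot _ _))// ler_wpM2r//.
Unshelve. all: by end_near. Qed.

Lemma closed_kernel_hdot (X : hilbertType R) (w : X) :
  closed [set x : X | '[w, x] = 0].
Proof.
apply: (preimage_closed (f := fun x : X => '[w, x] : R^o) (D := [set 0])).
  by move=> x _; exact: continuous_hdot.
exact: closed_eq.
Qed.

(** Riesz representation of [h |-> <y, T h>], bounded by [|y| M], makes the set in [adjoint]
    nonempty, so [xget] returns one of its members. *)
Lemma adjointE (X Y : hilbertType R) (T : X -> Y) (M : R) :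
  linear T -> (forall h, `|T h| <= M * `|h|) ->
  forall y h, '[adjoint T y, h] = '[y, T h].
Proof.
move=> Tlin TM y; suff: exists x : X, forall h, '[x, h] = '[y, T h].
  by move=> /(xgetPex (0 : X)).
have [||||h|z _ zP] := @riesz_subspace R X setT (fun h => '[y, T h]) (`|y| * M).
- exact: closedT.
- by [].
- by [].
- by move=> a u v; rewrite Tlin hdotDr hdotZr.
- by rewrite (le_trans (normr_hdot _ _))// -mulrA ler_wpM2l.
- by exists z => h; exact: zP.
Qed.

Section Projection.
Context {X : hilbertType R}.
Variable S : set X.
Hypotheses (Scl : closed S) (S0 : S 0).
Hypothesis Slin : forall a x y, S x -> S y -> S (a *: x + y).

Lemma orthogonal_projP y :
  S (orthogonal_proj S y) /\ orthogonal_compl S (y - orthogonal_proj S y).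
Proof.
apply: (@xgetPex _ 0 [set z | S z /\ orthogonal_compl S (y - z)]).
have [|x|z Sz zP] := @riesz_subspace R X S (hdot y) `|y| Scl S0 Slin.
- by move=> a u v; rewrite hdotDr hdotZr.
- exact: normr_hdot.
- by exists z; split=> // h Sh; rewrite hdotBl zP// subrr.
Qed.

(** A competing candidate [z] differs from [y - p] by a vector lying both in the complement of [S]
    ([C1]) and in the complement of that complement ([CC1]), hence orthogonal to itself. *)
Lemma orthogonal_proj_compl y :
  orthogonal_proj (orthogonal_compl S) y = y - orthogonal_proj S y.
Proof.
have [Sp Cp] := orthogonal_projP y.
set p := orthogonal_proj S y in Sp Cp *.
apply: xget_unique; first by split=> // z Cz; rewrite subKr hdotC Cz.
move=> z [Cz CCz]; apply/eqP; rewrite -subr_eq0; apply/eqP/hdot_eq0.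
have C1 : orthogonal_compl S (z - (y - p)).
  by move=> s Ss; rewrite hdotBl Cz// Cp// subrr.
have CC1 : orthogonal_compl (orthogonal_compl S) (p - (y - z)).
  by move=> s Cs; rewrite hdotBl CCz// hdotC Cs// subrr.
rewrite -{1}(_ : p - (y - z) = z - (y - p)) ?CC1//.
by rewrite !opprB !addrA [p + z]addrC.
Qed.

End Projection.
End AdjointAndProjection.

(** * Operator norm bounds and a Taylor estimate *)

Section DifferentialCalculus.
Context {R : realType}.

Lemma opnorm_le (U W : normedModType R) (T : U -> W) (c : R) : linear T ->
  (opnorm T <= c%:E)%E -> forall h, `|T h| <= c * `|h|.
Proof.
move=> Tlin Tc h.
have T0 : T 0 = 0.
  by have := Tlin (-1) 0 0; rewrite scaler0 addr0 scaleN1r addNr.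
have TZ (a : R) x : T (a *: x) = a *: T x.
  by rewrite -[a *: x]addr0 Tlin T0 addr0.
have [->|h0] := eqVneq h 0; first by rewrite T0 !normr0 mulr0.
have hp : 0 < `|h| by rewrite normr_gt0.
suff : `|T (`|h|^-1 *: h)| <= c.
  rewrite TZ normrZ normfV normr_id -(ler_pM2l hp) mulrA mulfV ?gt_eqF//.
  by rewrite mul1r [X in _ <= X]mulrC.
rewrite -lee_fin (le_trans _ Tc)//; apply: ereal_sup_ubound.
exists (`|h|^-1 *: h) => //=.
by rewrite normrZ normfV normr_id mulVf// gt_eqF.
Qed.

Lemma diff_bounded (U W : normedModType R) (f : U -> W) (x : U) :
  differentiable f x -> exists M, forall h, `|'d f x h| <= M * `|h|.
Proof.
move=> fx.
have /linear_bounded_continuous/linear_boundedP : continuous ('d f x).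
  exact: diff_continuous.
by move=> /pinfty_ex_gt0[M _ MP]; exists M.
Qed.

Context {X Y : hilbertType R}.
Variable K : X -> Y.
Hypothesis Kdiff : forall x, differentiable K x.

Lemma is_derive_hdot_line (w : Y) (x h : X) (t : R) :
  is_derive t (1 : R) (fun s : R => '[w, K (x + s *: h)] : R^o)
    '[w, 'd K (x + t *: h) h].
Proof.
have dg : is_diff (t : R^o) (fun s : R^o => x + s *: h) ( *:%R^~ h).
  rewrite (_ : (fun _ => _) = cst x + *:%R^~ h)//.
  by apply: is_diff_eq; rewrite add0r.
have dK := differentiableP (Kdiff (x + t *: h)).
have dw : is_diff (K (x + t *: h)) (hdot w : Y -> R^o) (hdot w).
  have cw : continuous (hdot w : {linear Y -> R^o}) by exact: continuous_hdot.
  by apply: DiffDef; [exact: linear_differentiable|rewrite (diff_lin _ cw)].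
have dKg : is_diff (t : R^o) (K \o (fun s : R^o => x + s *: h))
    ('d K (x + t *: h) \o *:%R^~ h).
  exact: is_diff_comp.
have df : is_diff (t : R^o)
    ((hdot w : Y -> R^o) \o (K \o (fun s : R^o => x + s *: h)))
    ((hdot w : Y -> R^o) \o ('d K (x + t *: h) \o *:%R^~ h)).
  exact: is_diff_comp.
have fd := ex_diff (is_diff_def := df).
apply: DeriveDef; first exact: diff_derivable.
by rewrite deriveE// diff_val /= scale1r.
Qed.

(** The mean value theorem is applied to [psi], whose quadratic coefficient [c] is chosen so that
    its derivative is nonpositive between [0] and [1]; hence [psi 1 <= psi 0]. This keeps the factor
    [1 / 2] that a direct mean value bound would lose. *)
Lemma hdot_taylor (V : set X) (L : R) (w : Y) (x h : X) :
  (forall t, 0 <= t <= 1 -> V (x + t *: h)) ->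
  (forall x x' k, V x -> V x' ->
    `|'d K x k - 'd K x' k| <= L * `|x - x'| * `|k|) ->
  '[w, K (x + h) - K x - 'd K x h] <= L / 2 * `|w| * `|h| ^+ 2.
Proof.
move=> Vseg KL; set c := L / 2 * `|w| * `|h| ^+ 2.
set k := '[w, 'd K x h].
pose psi (t : R) : R := '[w, K (x + t *: h)] - t * k - c * t ^+ 2.
have dpsi (t : R) : is_derive t (1 : R) (psi : R^o -> R^o)
    ('[w, 'd K (x + t *: h) h] - k - 2 * c * t).
  have dw := is_derive_hdot_line w x h t.
  rewrite (_ : psi = (fun s : R => '[w, K (x + s *: h)] : R^o)
     - k \*: (id : R^o -> R^o) - c \*: ((id : R -> R) ^+ 2)).
    apply: is_derive_eq; rewrite /GRing.scale/= expr1; ring.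
  by apply/funext => s; rewrite /psi [s * k]mulrC.
have [|s sI] := @MVT R psi _ 0 1 ltr01 (fun t _ => dpsi t).
  apply: derivable_within_continuous => s _.
  exact: (@ex_derive _ _ _ _ _ _ _ (dpsi s)).
rewrite /psi scale1r scale0r addr0 mul1r mul0r expr1n expr0n mulr1 mulr0 !subr0.
rewrite mulr1 => psi1.
have s0 : 0 < s by rewrite (itvP sI).
have Vx : V x by have := Vseg 0; rewrite scale0r addr0 lexx ler01; exact.
have Vs : V (x + s *: h) by apply: Vseg; rewrite !ltW ?(itvP sI).
suff : '[w, 'd K (x + s *: h) h] - k <= 2 * c * s.
  by rewrite !hdotBr -/k => hs; lra.
rewrite -hdotBr (le_trans (hdot_le_norm _ _))//.
have := KL _ _ h Vs Vx; rewrite (addrC x) addrK normrZ gtr0_norm// => hs.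
rewrite (le_trans (ler_wpM2l (normr_ge0 w) hs))// /c.
by rewrite le_eqVlt; apply/orP; left; apply/eqP; field.
Qed.

End DifferentialCalculus.

(** * Scalar inequalities *)

Section RealInequalities.
Context {R : realType}.
Implicit Types p z n q rho zeta : R.

(** Young's inequality for [z * 1] with exponents [p] and [p / (p - 1)], multiplied by [p]. The case
    [p = 1], without a finite conjugate exponent, is an equality. *)
Lemma powR_bernoulli p z : 1 <= p -> 0 <= z -> p * z <= z `^ p + p - 1.
Proof.
rewrite le_eqVlt => /predU1P[<-|p1] z0; first by rewrite powRr1//; lra.
have p0 : 0 < p by lra.
have q0 : 0 < p / (p - 1) by rewrite divr_gt0// subr_gt0.
have pq : p^-1 + (p / (p - 1))^-1 = 1.
  by rewrite invf_div; field; rewrite gt_eqF.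
have := conjugate_powR z0 ler01 p0 q0 pq.
rewrite powR1 mulr1 mul1r invf_div -(ler_pM2l p0) mulrDr mulrCA mulfV ?gt_eqF//.
by rewrite mulr1 mulrCA mulfV ?gt_eqF//; lra.
Qed.

(* In terms of z = q / (p zeta n) this is Bernoulli's p z <= z^p + p - 1. *)
Lemma weighted_young p zeta q n rho :
  1 <= p <= 2 -> 0 < zeta -> 0 <= q -> 0 <= n <= rho ->
  q * n <= rho `^ (2 - p) * p `^ (- p) * zeta `^ (1 - p) * q `^ p
           + (p - 1) * zeta * n ^+ 2.
Proof.
move=> /andP[p1 p2] zeta0 q0 /andP[n0 nrho].
have p0 : 0 < p by lra.
have [n_eq0|n_neq0] := eqVneq n 0.
  by rewrite n_eq0 mulr0 expr0n mulr0 addr0 !mulr_ge0 ?powR_ge0.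
have {n0 n_neq0} n0 : 0 < n by rewrite lt_neqAle eq_sym n_neq0.
(* As [2 - p >= 0], lowering [rho] to [n] only strengthens the claim; then [zeta n^2] factors out of
   every term. *)
suff h : q * n <= n `^ (2 - p) * p `^ (- p) * zeta `^ (1 - p) * q `^ p
           + (p - 1) * zeta * n ^+ 2.
  rewrite (le_trans h)// lerD2r !ler_wpM2r ?powR_ge0//.
  by rewrite ge0_ler_powR ?nnegrE ?subr_ge0// ltW// (lt_le_trans n0).
set z := q / (p * zeta * n).
have z0 : 0 <= z by rewrite divr_ge0// !mulr_ge0 ?ltW.
have -> : q * n = zeta * n ^+ 2 * (p * z) by rewrite /z; field; rewrite !gt_eqF.
have -> : n `^ (2 - p) * p `^ (- p) * zeta `^ (1 - p) * q `^ p =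
    zeta * n ^+ 2 * z `^ p.
  have [p_ge0 zeta_ge0 n_ge0] : [/\ 0 <= p, 0 <= zeta & 0 <= n].
    by split; exact: ltW.
  have pzn0 : 0 <= p * zeta * n by rewrite !mulr_ge0.
  rewrite /z powRM ?invr_ge0// -powR_inv1// -powRrM mulN1r !powRM ?mulr_ge0//.
  rewrite (powRD (x := n) (r := 2)) ?(gt_eqF n0) ?implybT//.
  rewrite (powRD (x := zeta) (r := 1)) ?(gt_eqF zeta0) ?implybT//.
  by rewrite powRr1// powR_mulrn//; ring.
have zn0 : 0 < zeta * n ^+ 2 by rewrite mulr_gt0// exprn_gt0.
have := ler_wpM2l (ltW zn0) (powR_bernoulli p z p1 z0).
by rewrite !mulrBr mulrDr => h; lra.
Qed.

(** The witness [c] is the determinant over the trace of the matrix of the form, a lower bound for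
    its smaller eigenvalue. With it, [a - c] times the difference of the two sides is a sum of two
    squares. *)
Lemma quadratic_form_lb (a b r : R) : 0 < a -> 0 < b -> r ^+ 2 < 4 * a * b ->
  exists2 c, 0 < c & forall x y, c * (x ^+ 2 + y ^+ 2) <=
    a * x ^+ 2 - r * (x * y) + b * y ^+ 2.
Proof.
move=> a0 b0 rab; have ab0 : 0 < 4 * (a + b) by rewrite mulr_gt0// addr_gt0.
pose c := (4 * a * b - r ^+ 2) / (4 * (a + b)).
have cE : 4 * (a + b) * c = 4 * a * b - r ^+ 2.
  by rewrite /c mulrCA mulfV ?mulr1// gt_eqF.
have c0 : 0 < c by rewrite divr_gt0// subr_gt0.
exists c => // x y.
have ca : 0 < a - c.
  by rewrite -(pmulr_rgt0 _ ab0) mulrBr cE; nra.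
rewrite -subr_ge0 -(pmulr_rge0 _ ca).
suff -> : (a - c) * (a * x ^+ 2 - r * (x * y) + b * y ^+ 2
    - c * (x ^+ 2 + y ^+ 2)) =
    ((a - c) * x - r / 2 * y) ^+ 2 + (c * y) ^+ 2.
  by rewrite addr_ge0 ?sqr_ge0.
apply/eqP; rewrite -subr_eq0; apply/eqP.
rewrite (_ : _ - _ = (4 * a * b - r ^+ 2 - 4 * (a + b) * c) / 4 * y ^+ 2).
  by rewrite cE subrr !mul0r.
by field.
Qed.

End RealInequalities.

(** * The subspaces [Y_L] and [Y_NL] and the linearisation errors of [K] *)

Section LinearPart.
Context {R : realType} {X Y : hilbertType R}.
Variable K : X -> Y.
Implicit Types y : Y.

(** [Y_L] is the set of vectors orthogonal to all linearity defects [K (a u + v) - a K u - K v], an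
    intersection of closed kernels. *)
Lemma closed_Y_L : closed (Y_L K).
Proof.
rewrite (_ : Y_L K = \bigcap_(auv in setT)
    [set y | '[K (auv.1.1 *: auv.1.2 + auv.2) - auv.1.1 *: K auv.1.2
              - K auv.2, y] = 0]).
  by apply: closed_bigI => auv _; exact: closed_kernel_hdot.
apply/seteqP; split=> y /= yP.
  move=> [[a u] v] _ /=; rewrite hdotC !hdotBr hdotZr (yP a u v); ring.
move=> a u v; have /= := yP (a, u, v) I.
rewrite hdotC !hdotBr hdotZr /= => h.
by apply/eqP; rewrite -subr_eq0 opprD addrA h.
Qed.

Lemma Y_L0 : Y_L K 0.
Proof. by move=> a u v; rewrite !hdot0l mulr0 addr0. Qed.

Lemma Y_L_lin (a : R) y1 y2 : Y_L K y1 -> Y_L K y2 -> Y_L K (a *: y1 + y2).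
Proof.
move=> y1P y2P b u v; rewrite !hdotDl !hdotZl y1P y2P /=; ring.
Qed.

Lemma P_L_in y : Y_L K (P_L K y).
Proof. exact: (orthogonal_projP _ closed_Y_L Y_L0 Y_L_lin y).1. Qed.

Lemma P_NLE y : P_NL K y = y - P_L K y.
Proof. exact: orthogonal_proj_compl closed_Y_L Y_L0 Y_L_lin y. Qed.

Lemma hdot_P_L_P_NL y : '[P_L K y, P_NL K y] = 0.
Proof.
rewrite hdotC P_NLE.
exact: (orthogonal_projP _ closed_Y_L Y_L0 Y_L_lin y).2 (P_L_in y).
Qed.

Lemma P_L_addE y : P_L K y + P_NL K y = y.
Proof. by rewrite P_NLE addrC subrK. Qed.

Lemma hdot_P_L y : '[P_L K y, y] = `|P_L K y| ^+ 2.
Proof. by rewrite -{2}[y]P_L_addE hdotDr hdot_P_L_P_NL addr0 hdotE. Qed.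

Lemma hdot_P_NL y : '[P_NL K y, y] = `|P_NL K y| ^+ 2.
Proof.
by rewrite -{2}[y]P_L_addE hdotDr hdotC hdot_P_L_P_NL add0r hdotE.
Qed.

Lemma sqr_norm_P_L_P_NL y :
  `|y| ^+ 2 = `|P_L K y| ^+ 2 + `|P_NL K y| ^+ 2.
Proof. by rewrite -{1}[y]P_L_addE sqr_normD hdot_P_L_P_NL mulr0 addr0. Qed.

Lemma ball_NLE yh y (r : R) : ball_NL K yh r y -> `|P_NL K (y - yh)| <= r.
Proof. by rewrite /ball_NL /sqnorm_op /= hdot_P_NL sqrtr_sqr normr_id. Qed.

Hypothesis Kdiff : forall x, differentiable K x.

(** Along a line, [s |-> <y, K (x + s h)>] is affine with slope [<y, K h>]; comparing this slope
    with the chain rule at [s = 0] gives the claim. *)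
Lemma Y_L_diff y x h : Y_L K y -> '[y, 'd K x h] = '[y, K h].
Proof.
move=> yP.
have d' : is_derive (0 : R^o) (1 : R)
    ('[y, K h] \*: (id : R^o -> R^o) + cst '[y, K x]) ('[y, K h] : R^o).
  by apply: is_derive_eq; rewrite addr0 /GRing.scale /= mulr1.
have d := is_derive_hdot_line K Kdiff y x h 0.
rewrite (_ : (fun s : R => '[y, K (x + s *: h)] : R^o) =
  '[y, K h] \*: (id : R^o -> R^o) + cst '[y, K x]) in d; last first.
  by apply/funext => s; rewrite (addrC x) yP mulrC.
have := @derive_val _ _ _ _ _ _ _ d; rewrite scale0r addr0 => <-.
exact: (@derive_val _ _ _ _ _ _ _ d').
Qed.

(** The [Y_L] part pairs to zero by [Y_L_diff]. So [rho], which bounds only the [P_NL] component,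
    suffices to control the nonlinearity. *)
Lemma hdot_P_NL_remainder y x x' :
  '[y, K x' - K x - 'd K x (x' - x)] =
  '[P_NL K y, K x' - K x - 'd K x (x' - x)].
Proof.
rewrite -{1}[y]P_L_addE hdotDl [X in X + _](_ : _ = 0) ?add0r//.
rewrite !hdotBr Y_L_diff; last exact: P_L_in.
by rewrite -{1}(subrK x x') -{1}(scale1r (x' - x)) P_L_in; ring.
Qed.

Lemma hdot_P_NL_diffB y x x' h :
  '[y, 'd K x h - 'd K x' h] = '[P_NL K y, 'd K x h - 'd K x' h].
Proof.
rewrite -{1}[y]P_L_addE hdotDl [X in X + _](_ : _ = 0) ?add0r//.
by rewrite hdotBr !Y_L_diff ?subrr//; exact: P_L_in.
Qed.

End LinearPart.

(** * One-step decrease and coercivity of the energy *)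

Section EnergyDecrease.
Context {R : realType} {X Y : hilbertType R}.
Variables (K : X -> Y) (XK : set X) (xh : X) (yh : Y).
Variables gG tgG gL gNL tgF L RK lambda theta p rho zeta tau sigma kappa : R.
Let omega : R := (1 + 2 * tgG * tau)^-1.

Hypothesis Kdiff : forall x, differentiable K x.
Hypothesis XK_segment : forall x x' t, 0 <= t <= 1 -> XK x -> XK x' ->
  XK (x + t *: (x' - x)).
Hypothesis dK_lipschitz : forall x x' k, XK x -> XK x' ->
  `|'d K x k - 'd K x' k| <= L * `|x - x'| * `|k|.
Hypothesis dK_bound : forall x k, XK x -> `|'d K x k| <= RK * `|k|.
Hypothesis three_point : forall x x', XK x -> XK x' ->
  theta * `|K xh - K x - 'd K x (xh - x)| `^ p - lambda / 2 * `|x - x'| ^+ 2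
  <= '[yh, 'd K x' (x - xh) - 'd K xh (x - xh)]
     + (gG - tgG) * `|x - xh| ^+ 2.

Hypothesis L_ge0 : 0 <= L.
Hypotheses (p_itv : 1 <= p <= 2) (zeta_gt0 : 0 < zeta).
Hypotheses (tgG_gt0 : 0 < tgG) (tau_gt0 : 0 < tau) (sigma_gt0 : 0 < sigma).
Hypotheses (gL_ge : tgF <= gL) (gNL_ge : tgF + (p - 1) * zeta <= gNL).
Hypothesis sigma_tgF : sigma * tgF = tgG * tau.
Hypothesis theta_ge :
  rho `^ (2 - p) * p `^ (- p) * omega^-1 * zeta `^ (1 - p) <= theta.
Hypothesis tau_le : tau * (3 * L * rho + lambda) <= kappa.
Hypothesis tau_sigma_le : RK ^+ 2 * tau * sigma <= 1 - kappa.

Let iw_gt1 : 1 < 1 + 2 * tgG * tau.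
Proof. by rewrite ltrDl !mulr_gt0. Qed.

Let omega_gt0 : 0 < omega.
Proof. by rewrite invr_gt0 (lt_trans ltr01). Qed.

Let omega_lt1 : omega < 1.
Proof. by rewrite invf_lt1// (lt_trans ltr01). Qed.

(** Half the squared distance to [(xh, yh)] in the [x]-dependent metric with diagonal blocks
    [1 / tau] and [1 / (sigma omega)], and with minus ['d K x] and minus its adjoint off the
    diagonal. *)
Definition energy (x : X) (y : Y) : R :=
  `|x - xh| ^+ 2 / (2 * tau) - '[y - yh, 'd K x (x - xh)]
  + `|y - yh| ^+ 2 / (2 * sigma * omega).

Lemma diff_adjointE x y h : '[adjoint ('d K x) y, h] = '[y, 'd K x h].
Proof.
have [M dM] := diff_bounded _ _ _ _ (Kdiff x).
by apply: adjointE dM _ _; exact: linearP.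
Qed.

(** [three_point] is used with [x1] as its first point and the old iterate [x] as its second, since
    the step evaluates the derivative at [x]. Of [gG] it leaves [tgG], which raises the weight
    [1 / (2 tau)] to [1 / (2 tau omega)]. *)
Lemma primal_descent x y x1 q : XK x -> XK x1 ->
  x - tau *: adjoint ('d K x) y = x1 + tau *: q ->
  gG * `|x1 - xh| ^+ 2 <= '[q + adjoint ('d K xh) yh, x1 - xh] ->
  `|x1 - xh| ^+ 2 / (2 * tau * omega)
    + (1 / (2 * tau) - lambda / 2) * `|x1 - x| ^+ 2
    + theta * `|K xh - K x1 - 'd K x1 (xh - x1)| `^ p
    + '[y - yh, 'd K x (x1 - xh)]
  <= `|x - xh| ^+ 2 / (2 * tau).
Proof.
move=> Kx Kx1 step; set h := x1 - xh; have := three_point _ _ Kx1 Kx.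
rewrite -/h [X in _ -> _ <= X -> _]hdotDl diff_adjointE (hdotBr ('d K x h)).
rewrite (hdotBl y); set r := _ `^ p => h4 mono.
have stepE : '[x - x1, h] = tau * ('[y, 'd K x h] + '[q, h]).
  have /(congr1 (hdot^~ h)) := step.
  by rewrite hdotBl hdotDl !hdotZl diff_adjointE hdotBl => e; lra.
have pol : `|x - xh| ^+ 2 = `|x1 - x| ^+ 2 + 2 * '[x - x1, h] + `|h| ^+ 2.
  by rewrite (distrC x1 x) -sqr_normD /h addrA subrK.
have t2 : 0 < 2 * tau by rewrite mulr_gt0.
have main := ler_wpM2l (ltW t2) (lerD mono h4).
rewrite -(ler_pM2l t2) pol stepE.
rewrite [X in _ <= X]mulrC (divfK (lt0r_neq0 t2)).
have -> : 2 * tau * (`|h| ^+ 2 / (2 * tau * omega)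
    + (1 / (2 * tau) - lambda / 2) * `|x1 - x| ^+ 2 + theta * r
    + ('[y, 'd K x h] - '[yh, 'd K x h])) =
    `|h| ^+ 2 * (1 + 2 * tgG * tau) + `|x1 - x| ^+ 2
    - tau * lambda * `|x1 - x| ^+ 2 + 2 * tau * theta * r
    + 2 * tau * ('[y, 'd K x h] - '[yh, 'd K x h]).
  by rewrite /omega; field; rewrite ?gt_eqF// (lt_trans ltr01).
lra.
Qed.

Lemma dual_descent y y1 z r :
  y + sigma *: z = y1 + sigma *: r ->
  gL * `|P_L K (y1 - yh)| ^+ 2 + gNL * `|P_NL K (y1 - yh)| ^+ 2
    <= '[r - K xh, y1 - yh] ->
  `|y1 - yh| ^+ 2 / (2 * sigma * omega) + `|y1 - y| ^+ 2 / (2 * sigma)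
    + (p - 1) * zeta * `|P_NL K (y1 - yh)| ^+ 2
  <= `|y - yh| ^+ 2 / (2 * sigma) + '[y1 - yh, z - K xh].
Proof.
set h := y1 - yh => step mono.
have stepE : '[y - y1, h] = sigma * ('[r, h] - '[z, h]).
  have /(congr1 (hdot^~ h)) := step.
  by rewrite hdotBl !hdotDl !hdotZl => e; lra.
have pol : `|y - yh| ^+ 2 = `|y1 - y| ^+ 2 + 2 * '[y - y1, h] + `|h| ^+ 2.
  by rewrite (distrC y1 y) -sqr_normD /h addrA subrK.
(* The modulus splits: [tgF] raises the weight of [h] by the factor [1 / omega], through
   [sigma_tgF], while [(p - 1) zeta] on the [P_NL] part is held in reserve for Young's
   inequality. *)
have gain : tgF * `|h| ^+ 2 + (p - 1) * zeta * `|P_NL K h| ^+ 2 <=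
    '[r, h] - '[K xh, h].
  rewrite (sqr_norm_P_L_P_NL K h).
  have := ler_wpM2r (sqr_ge0 `|P_L K h|) gL_ge.
  have := ler_wpM2r (sqr_ge0 `|P_NL K h|) gNL_ge.
  by move: mono; rewrite hdotBl => *; lra.
have s2 : 0 < 2 * sigma by rewrite mulr_gt0.
have main := ler_wpM2l (ltW s2) gain.
rewrite -(ler_pM2l s2) pol stepE (hdotC h) hdotBl.
have -> : 2 * sigma * (`|h| ^+ 2 / (2 * sigma * omega)
    + `|y1 - y| ^+ 2 / (2 * sigma)
    + (p - 1) * zeta * `|P_NL K h| ^+ 2) =
    `|h| ^+ 2 * (1 + 2 * (sigma * tgF)) + `|y1 - y| ^+ 2
    + 2 * sigma * ((p - 1) * zeta * `|P_NL K h| ^+ 2).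
  rewrite sigma_tgF mulrA /omega.
  by field; rewrite ?gt_eqF// (lt_trans ltr01).
rewrite [X in _ <= X]mulrDr [X in _ <= X + _]mulrC (divfK (lt0r_neq0 s2)).
lra.
Qed.

(** With [e = x1 - x] and [n] the norm of the [P_NL] part, the Taylor error of the extrapolation
    costs [L / 2 n omega^2 |e|^2] ([h1]), and moving the derivative from [x1] to [x] costs
    [L n omega |e|^2] ([h2]). As [omega < 1] and [n <= rho], the total is at most
    [3 / 2 L rho omega |e|^2]. *)
Lemma coupling_le x x1 y1 : XK x -> XK x1 -> XK (x1 + omega *: (x1 - x)) ->
  `|P_NL K (y1 - yh)| <= rho ->
  '[y1 - yh, K (x1 + omega *: (x1 - x)) - K xh] <=
  '[y1 - yh, 'd K x1 (x1 - xh)] + omega * '[y1 - yh, 'd K x (x1 - x)]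
  + `|K xh - K x1 - 'd K x1 (xh - x1)| * `|P_NL K (y1 - yh)|
  + 3 / 2 * L * rho * omega * `|x1 - x| ^+ 2.
Proof.
set b := y1 - yh; set e := x1 - x; move=> Kx Kx1 Kxb nrho.
set n := `|P_NL K b| in nrho *.
set rem := K xh - K x1 - 'd K x1 (xh - x1).
have h1 : '[b, K (x1 + omega *: e) - K x1 - 'd K x1 (omega *: e)] <=
    L / 2 * n * (omega * `|e|) ^+ 2.
  have := hdot_P_NL_remainder K Kdiff b x1 (x1 + omega *: e).
  rewrite (_ : x1 + omega *: e - x1 = omega *: e); last by rewrite addrC addKr.
  move=> ->; rewrite -[omega in omega * `|e|]gtr0_norm// -normrZ.
  apply: (hdot_taylor K Kdiff XK L _ x1 (omega *: e) _ dK_lipschitz) => t tI.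
  have := XK_segment x1 (x1 + omega *: e) t tI Kx1 Kxb.
  by rewrite (_ : x1 + omega *: e - x1 = omega *: e)// addrC addKr.
have h2 : '[b, 'd K x1 e - 'd K x e] <= n * (L * `|e| * `|e|).
  rewrite hdot_P_NL_diffB// (le_trans (hdot_le_norm _ _))// ler_wpM2l//.
  exact: dK_lipschitz.
have h3 : - '[b, rem] <= `|rem| * n.
  rewrite hdot_P_NL_remainder// -hdotNl (le_trans (hdot_le_norm _ _))//.
  by rewrite normrN mulrC.
have remE : '[b, rem] = '[b, K xh] - '[b, K x1] + '[b, 'd K x1 (x1 - xh)].
  by rewrite /rem -(opprB x1 xh) linearN /= opprK hdotDr hdotBr.
have ne : n * `|e| ^+ 2 <= rho * `|e| ^+ 2 by rewrite ler_wpM2r ?sqr_ge0.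
have oLne := ler_wpM2l (mulr_ge0 (ltW omega_gt0) L_ge0) ne.
have oe : omega * (omega * L * (n * `|e| ^+ 2)) <= omega * L * (n * `|e| ^+ 2).
  have o0 := ltW omega_gt0; have n0 : 0 <= n by exact: normr_ge0.
  by apply: ler_piMl (ltW omega_lt1); rewrite !mulr_ge0 ?sqr_ge0.
have := ler_wpM2l (ltW omega_gt0) h2.
move: h1 h3; rewrite remE linearZ /= !hdotBr hdotZr => h1 h3 h2'.
lra.
Qed.

Lemma energy_decrease x y x1 y1 q r :
  XK x -> XK x1 -> XK (x1 + omega *: (x1 - x)) ->
  `|P_NL K (y1 - yh)| <= rho ->
  x - tau *: adjoint ('d K x) y = x1 + tau *: q ->
  gG * `|x1 - xh| ^+ 2 <= '[q + adjoint ('d K xh) yh, x1 - xh] ->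
  y + sigma *: K (x1 + omega *: (x1 - x)) = y1 + sigma *: r ->
  gL * `|P_L K (y1 - yh)| ^+ 2 + gNL * `|P_NL K (y1 - yh)| ^+ 2
    <= '[r - K xh, y1 - yh] ->
  energy x1 y1 <= omega * energy x y.
Proof.
move=> Kx Kx1 Kxb nrho pstep pmono dstep dmono.
have P := primal_descent _ _ _ _ Kx Kx1 pstep pmono.
have D := dual_descent _ _ _ _ dstep dmono.
have C := coupling_le _ _ _ Kx Kx1 Kxb nrho.
(* The first summand is paid by the [theta] term of [P] scaled by [omega], the second by the reserve
   in [D]. *)
have Yg : `|K xh - K x1 - 'd K x1 (xh - x1)| * `|P_NL K (y1 - yh)| <=
    omega * theta * `|K xh - K x1 - 'd K x1 (xh - x1)| `^ p
    + (p - 1) * zeta * `|P_NL K (y1 - yh)| ^+ 2.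
  have nI : 0 <= `|P_NL K (y1 - yh)| <= rho by rewrite normr_ge0.
  have := weighted_young _ _ _ _ _ p_itv zeta_gt0
    (normr_ge0 (K xh - K x1 - 'd K x1 (xh - x1))) nI.
  move=> /le_trans; apply.
  rewrite lerD2r ler_wpM2r ?powR_ge0// -ler_pdivrMl//.
  by rewrite mulrC mulrAC.
(* The derivative at [x] along [x1 - x] is paired with [y - yh] in [P] and with [y1 - yh] in [C];
   only the pairing with [y1 - y] survives. *)
have S : - (RK * `|y1 - y| * `|x1 - x|) <=
    '[y - yh, 'd K x (x1 - x)] - '[y1 - yh, 'd K x (x1 - x)].
  rewrite -hdotBl (_ : y - yh - (y1 - yh) = - (y1 - y)); last first.
    by rewrite !opprB addrA subrK.
  rewrite hdotNl lerN2 (le_trans (hdot_le_norm _ _))//.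
  by rewrite (mulrC RK) -mulrA ler_wpM2l// dK_bound.
have o0 := ltW omega_gt0.
(* The proximal term [|x1 - x|^2 / (2 tau)] is shared out: the fraction [1 - kappa], together with
   the dual proximal term, pays for the mismatch in [S], and [kappa] pays for the curvature terms in
   [T]. *)
have Q : omega * (RK * `|y1 - y| * `|x1 - x|) <=
    omega * ((1 - kappa) / (2 * tau) * `|x1 - x| ^+ 2)
    + `|y1 - y| ^+ 2 / (2 * sigma).
  have s0 : 0 < 2 * sigma by rewrite mulr_gt0.
  have kt : RK ^+ 2 * sigma <= (1 - kappa) / tau.
    by rewrite ler_pdivlMr// mulrAC.
  have ktE := ler_wpM2r (sqr_ge0 `|x1 - x|) kt.
  have oD : omega * (`|y1 - y| ^+ 2 / (2 * sigma)) <=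
      `|y1 - y| ^+ 2 / (2 * sigma).
    by apply: ler_piMl (ltW omega_lt1); rewrite divr_ge0 ?sqr_ge0 ?ltW.
  rewrite (le_trans _ (lerD (lexx _) oD))// -mulrDr ler_wpM2l//.
  rewrite -subr_ge0 (_ : _ - _ =
    ((1 - kappa) / tau * `|x1 - x| ^+ 2 - RK ^+ 2 * sigma * `|x1 - x| ^+ 2) / 2
    + (sigma * RK * `|x1 - x| - `|y1 - y|) ^+ 2 / (2 * sigma)).
    by rewrite addr_ge0// divr_ge0 ?sqr_ge0 ?subr_ge0 ?(ltW s0).
  by field; rewrite !gt_eqF.
have T : omega * ((3 * L * rho + lambda) / 2 * `|x1 - x| ^+ 2) <=
    omega * (kappa / (2 * tau) * `|x1 - x| ^+ 2).
  rewrite ler_wpM2l// ler_wpM2r ?sqr_ge0// invfM mulrA (mulrAC kappa).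
  by rewrite ler_wpM2r// ler_pdivlMr// mulrC.
have split : 'd K x (x1 - xh) = 'd K x (x1 - x) + 'd K x (x - xh).
  by rewrite -linearD /= subrKA.
have := ler_wpM2l o0 P; have := ler_wpM2l o0 S.
rewrite /energy split hdotDr => S' P'.
have e1 : omega * (`|x1 - xh| ^+ 2 / (2 * tau * omega)) =
    `|x1 - xh| ^+ 2 / (2 * tau) by field; rewrite !gt_eqF.
have e2 : omega * (`|y - yh| ^+ 2 / (2 * sigma * omega)) =
    `|y - yh| ^+ 2 / (2 * sigma) by field; rewrite !gt_eqF.
have e3 : (1 - kappa) / (2 * tau) = 1 / (2 * tau) - kappa / (2 * tau).
  by rewrite mulrBl.
move: P' Q; rewrite e3 !mulrDr e1 e2 => P' Q.
lra.
Qed.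

(** The discriminant condition amounts to [RK^2 tau sigma omega < 1]. For [kappa = 0] the step bound
    gives only [RK^2 tau sigma <= 1]; strictness comes from [omega < 1]. *)
Lemma energy_coercive : 0 <= kappa ->
  exists2 c, 0 < c & forall x y, XK x ->
    c * (`|x - xh| ^+ 2 + `|y - yh| ^+ 2) <= energy x y.
Proof.
move=> kappa_ge0.
have t0 : 0 < (2 * tau)^-1 by rewrite invr_gt0 mulr_gt0.
have s0 : 0 < (2 * sigma * omega)^-1 by rewrite invr_gt0 !mulr_gt0.
have [|c c0 cP] := quadratic_form_lb _ _ RK t0 s0.
  rewrite (_ : 4 * _ * _ = (tau * sigma * omega)^-1); last first.
    by field; rewrite !gt_eqF.
  rewrite -[X in _ < X]mul1r ltr_pdivlMr ?mulr_gt0// !mulrA.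
  rewrite (le_lt_trans _ omega_lt1)// ler_piMl ?(ltW omega_gt0)//.
  by rewrite (le_trans tau_sigma_le)// gerBl.
exists c => // x y Kx; rewrite (le_trans (cP _ _))// /energy.
rewrite !(mulrC _^-1) lerD2r lerD2l lerN2 (le_trans (hdot_le_norm _ _))//.
by rewrite (mulrC _ `|y - yh|) mulrCA ler_wpM2l// dK_bound.
Qed.

End EnergyDecrease.

(** * Geometric decay and convergence of the iterates *)

Lemma geometric_decay (R : realType) (f : nat -> R) (w C : R) :
  0 < w < 1 -> (forall n, 0 <= f n <= C * w ^+ n) ->
  f N @[N --> \oo] --> (0 : R) /\ f =O_\oo (fun N => w ^+ N).
Proof.
move=> /andP[w0 w1] fP; split.
  apply: (@squeeze_cvgr _ _ _ _ (cst 0) (fun n => C * w ^+ n)).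
  - by apply: nearW => n; exact: fP.
  - exact: cvg_cst.
  - by apply: cvg_geometric; rewrite gtr0_norm.
apply: (iffRL (eqO_exP _ _ _)); exists (`|C| + 1).
  by rewrite /= ltr_wpDl.
apply: nearW => n; have /andP[f0 fn] := fP n.
have wn : 0 <= w ^+ n := exprn_ge0 n (ltW w0).
rewrite (ger0_norm f0) (ger0_norm wn) (le_trans fn)// ler_wpM2r//.
by rewrite ler_wpDr// ler_norm.
Qed.

Theorem theorem4p4 (R : realType) (X Y : hilbertType R)
  (G : X -> \bar R) (Fs : Y -> \bar R) (K : X -> Y)
  (G_proper : proper_function G) (G_convex : convex_efunction G)
  (G_lsc : lower_semicontinuous G)
  (Fs_proper : proper_function Fs) (Fs_convex : convex_efunction Fs)
  (Fs_lsc : lower_semicontinuous Fs)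
  (K_C1 : C1 K)
  (uh : X * Y) (uh_sol : H_map G Fs K uh 0)
  (XK XG : set X) (YF : set Y)
  (XK_nbhs : nbhs uh.1 XK) (XG_nbhs : nbhs uh.1 XG) (YF_nbhs : nbhs uh.2 YF)
  (XK_convex : convex_set (XK : set (convex_lmodType X)))
  (gG tgG gL gNL L RK lambda theta p rho zeta tau delta kappa : R)
  (gG_ge0 : 0 <= gG) (gL_ge0 : 0 <= gL) (gNL_ge0 : 0 <= gNL)
  (L_ge0 : 0 <= L) (RK_gt0 : 0 < RK) (lambda_ge0 : 0 <= lambda)
  (theta_ge0 : 0 <= theta) (p_itv : 1 <= p <= 2) (rho_ge0 : 0 <= rho)
  (tgG_gt0 : 0 < tgG) (zeta_gt0 : 0 < zeta)
  (delta_kappa : 0 <= delta <= kappa) (kappa_lt1 : kappa < 1)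
  (u : nat -> X * Y) :
  let tgF := Num.min gL (gNL - (p - 1) * zeta) in
  let sigma := tgG / tgF * tau in
  let omega := 1 / (1 + 2 * tgG * tau) in
  (* (A1) *)
  (forall x x', XK x -> XK x' ->
    (opnorm ('d K x \- 'd K x')%R <= (L * `|x - x'|)%:E)%E) ->
  (* (A2) *)
  (ereal_sup [set opnorm ('d K x) | x in XK] <= RK%:E)%E ->
  (* (A3) *)
  strongly_monotone_at (subdifferential G) (fun x => gG *: x)
    uh.1 (- adjoint ('d K (uh.1)) uh.2) XG ->
  strongly_monotone_at (subdifferential Fs)
    (fun y => gL *: P_L K y + gNL *: P_NL K y) uh.2 (K uh.1) YF ->
  (* (A4) *)
  (forall x x', XK x -> XK x' ->
    '[adjoint ('d K x' \- 'd K (uh.1)) uh.2, x - uh.1]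
      + (gG - tgG) * `|x - uh.1| ^+ 2
    >= theta * `|K uh.1 - K x - 'd K x (uh.1 - x)| `^ p
       - lambda / 2 * `|x - x'| ^+ 2) ->
  (* (A5) *)
  (forall i, ((XG `&` XK) `*` (ball_NL K uh.2 rho `&` YF)) (u i)) ->
  (forall i, XK (xbar (fun=> omega) (fst \o u) i)) ->
  (* parameter choices; division in \bar R obeys x / 0 = +oo for 0 < x and
     0 / 0 = 0, and 0 `^ 0 = 1 *)
  0 < tgF ->
  theta >= rho `^ (2 - p) * p `^ (- p) * omega^-1 * zeta `^ (1 - p) ->
  0 < tau ->
  (tau%:E <= Order.min (delta%:E / (3 * L * rho + lambda)%:E)
                       (Num.sqrt ((1 - kappa) * tgF / tgG) / RK)%:E)%E ->
  NL_PDHGM G Fs K (fun=> tau) (fun=> sigma) (fun=> omega) u ->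
  sqnorm_pair (u N - uh) @[N --> \oo] --> (0 : R) /\
  (fun N => sqnorm_pair (u N - uh)) =O_\oo (fun N => omega ^+ N).
Proof.
move=> tgF sigma omega lipschitz bounded monoG monoFs three_point iterates
  extrapolates tgF_gt0 theta_ge tau_gt0 tau_le steps.
have omegaE : omega = (1 + 2 * tgG * tau)^-1 by rewrite /omega div1r.
have Kdiff := K_C1.1.
have diffB_linear x x' : linear ('d K x \- 'd K x').
  by move=> a v w; rewrite /= (linearP ('d K x)) (linearP ('d K x')) scalerBr
    opprD addrACA.
have XK_segment x x' t : 0 <= t <= 1 -> XK x -> XK x' -> XK (x + t *: (x' - x)).
  move=> /andP[t0 t1] Kx Kx'; apply: set_mem.
  rewrite (_ : x + t *: (x' - x) = t *: x' + (1 - t) *: x).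
    exact: XK_convex x' x (Itv01 t0 t1) (mem_set Kx') (mem_set Kx).
  by rewrite scalerBr scalerBl scale1r addrCA.
have dK_lipschitz x x' k : XK x -> XK x' ->
    `|'d K x k - 'd K x' k| <= L * `|x - x'| * `|k|.
  move=> Kx Kx'.
  exact: opnorm_le (diffB_linear x x') (lipschitz x x' Kx Kx') k.
have dK_bound x k : XK x -> `|'d K x k| <= RK * `|k|.
  move=> Kx; apply: opnorm_le; first exact: linearP.
  by apply: le_trans bounded; apply: ereal_sup_ubound; exists x.
have three_point' x x' : XK x -> XK x' ->
    theta * `|K uh.1 - K x - 'd K x (uh.1 - x)| `^ p
      - lambda / 2 * `|x - x'| ^+ 2
    <= '[uh.2, 'd K x' (x - uh.1) - 'd K (uh.1) (x - uh.1)]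
       + (gG - tgG) * `|x - uh.1| ^+ 2.
  move=> Kx Kx'; rewrite (le_trans (three_point x x' Kx Kx'))// lerD2r.
  have [M1 dM1] := diff_bounded _ _ _ _ (Kdiff x').
  have [M2 dM2] := diff_bounded _ _ _ _ (Kdiff uh.1).
  rewrite (adjointE _ _ _ (M1 + M2) (diffB_linear _ _))// => h.
  by rewrite mulrDl (le_trans (ler_normB _ _))// lerD.
have sigma_gt0 : 0 < sigma by rewrite !mulr_gt0 ?invr_gt0.
have sigma_tgF : sigma * tgF = tgG * tau.
  by rewrite /sigma; field; rewrite gt_eqF.
have gL_ge : tgF <= gL by rewrite ge_min lexx.
have gNL_ge : tgF + (p - 1) * zeta <= gNL by rewrite -lerBrDr ge_min lexx orbT.
have [delta_ge0 delta_le] := andP delta_kappa.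
move: tau_le; rewrite le_min => /andP[tau_le1 tau_le2].
have tau_le : tau * (3 * L * rho + lambda) <= kappa.
  have S0 : 0 <= 3 * L * rho + lambda by rewrite addr_ge0 ?mulr_ge0.
  (* If the denominator vanishes, so does the left side, and [0 <= delta <= kappa] concludes
     whatever the quotient is. *)
  have [->|S_neq0] := eqVneq (3 * L * rho + lambda) 0.
    by rewrite mulr0 (le_trans delta_ge0).
  move: tau_le1; rewrite inver (negbTE S_neq0) -EFinM lee_fin.
  rewrite ler_pdivlMr; last by rewrite lt_neqAle eq_sym S_neq0.
  by move=> /le_trans; apply.
have tau_sigma_le : RK ^+ 2 * tau * sigma <= 1 - kappa.
  have k1 : 0 <= 1 - kappa by rewrite subr_ge0 ltW.
  have [tgF_ge0 tgG_ge0] : 0 <= tgF /\ 0 <= tgG by rewrite !ltW.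
  have q0 : 0 <= (1 - kappa) * tgF / tgG by rewrite divr_ge0// mulr_ge0.
  move: tau_le2; rewrite lee_fin ler_pdivlMr// => h.
  (* The second step length bound is squared, then multiplied by [tgG / tgF = sigma / tau]. *)
  have : (tau * RK) ^+ 2 <= (1 - kappa) * tgF / tgG.
    by rewrite -(sqr_sqrtr q0) ler_pXn2r ?nnegrE ?sqrtr_ge0// mulr_ge0// ltW.
  rewrite -subr_ge0 => h2; rewrite -subr_ge0.
  have -> : 1 - kappa - RK ^+ 2 * tau * sigma =
    ((1 - kappa) * tgF / tgG - (tau * RK) ^+ 2) * (tgG / tgF).
    by rewrite /sigma; field; rewrite !gt_eqF.
  by rewrite mulr_ge0// divr_ge0.
have theta_ge' : rho `^ (2 - p) * p `^ (- p) * ((1 + 2 * tgG * tau)^-1)^-1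
    * zeta `^ (1 - p) <= theta by rewrite -omegaE.
pose E i := energy K uh.1 uh.2 tgG tau sigma (u i).1 (u i).2.
have EP i : E i.+1 <= omega * E i.
  have [q qG qE] := (steps i).1; have [r rF rE] := (steps i).2.
  have [[XG1 XK1] [NL1 YF1]] := iterates i.+1.
  have [[_ XK0] _] := iterates i.
  have XKb := extrapolates i; rewrite /xbar omegaE /= in rE XKb.
  rewrite omegaE.
  apply: (energy_decrease K XK uh.1 uh.2 gG tgG gL gNL tgF L RK lambda theta p
    rho zeta tau sigma kappa Kdiff XK_segment dK_lipschitz dK_bound three_point'
    L_ge0 p_itv zeta_gt0 tgG_gt0 tau_gt0 sigma_gt0 gL_ge gNL_ge sigma_tgF
    theta_ge' tau_le tau_sigma_le _ _ _ _ _ _ XK0 XK1 XKb _ qE _ rE).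
  - exact: ball_NLE.
  - by have := monoG.2 _ _ XG1 qG; rewrite opprK /sqnorm_op hdotZl hdotE.
  - have := monoFs.2 _ _ YF1 rF.
    by rewrite /sqnorm_op [X in X <= _ -> _]hdotDl !hdotZl hdot_P_L hdot_P_NL.
have omega_itv : 0 < omega < 1.
  rewrite omegaE invr_gt0 invf_lt1; last by rewrite addr_gt0// !mulr_gt0.
  by rewrite ltrDl !mulr_gt0// addr_gt0// !mulr_gt0.
have [c c0 cP] : exists2 c, 0 < c & forall x y, XK x ->
    c * (`|x - uh.1| ^+ 2 + `|y - uh.2| ^+ 2) <=
    energy K uh.1 uh.2 tgG tau sigma x y.
  by apply: (energy_coercive K XK _ _ tgG RK tau sigma kappa) => //;
    exact: le_trans delta_le.
(* The constant is the initial energy over the coercivity constant: [c] times the squared error is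
   at most [E N <= omega ^+ N * E 0]. *)
apply: (geometric_decay R _ _ (E 0%N / c) omega_itv) => N.
have EN : E N <= omega ^+ N * E 0%N.
  elim: N => [|N IH]; first by rewrite expr0 mul1r.
  have /andP[w0 _] := omega_itv.
  by rewrite (le_trans (EP N))// exprS -mulrA ler_wpM2l// ltW.
have [[_ KN] _] := iterates N.
rewrite addr_ge0 ?sqr_ge0//= mulrAC ler_pdivlMr// mulrC.
by rewrite (le_trans (cP _ _ KN))// (le_trans EN)// mulrC.
Qed.
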